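(* Let $R$ be a real closed field, let $S$ be its dense completion, and let $(X,R,d)$ be an $R$-metric space with completion set $\overline X$ and function $\overline d$ as defined in the context. Then $\overline d$ is a well-defined $S$-metric on $\overline X$, and $(\overline X,S,\overline d)$ is complete. Moreover, the map $\iota:X\to\overline X$, $x\mapsto[(x)_{i<\kappa}]$ (class of the constant sequence), is an isometric embedding, and $\iota(X)$ is dense in $\overline X$.
   Context: For a real closed field $R$, an $R$-metric space $(X,R,d)$ is a set $X$ with $d:X\times X\to R^{\ge0}$ satisfying the usual metric axioms ($d(x,y)=0$ iff $x=y$, symmetry, triangle inequality); balls of radius in $R^{>0}$ generate its topology. The dense completion $S$ of $R$ is the real closed field extension of $R$ (unique up to unique isomorphism over $R$) in which $R$ is dense and into which every real closed field extension of $R$ in which $R$ is dense embeds uniquely over $R$. Let $\kappa=\operatorname{ci}(R^{>0})$ be the least cardinality of a coinitial subset of $R^{>0}$; it equals $\operatorname{ci}(S^{>0})$. A $\kappa$-sequence $(x_i)_{i<\kappa}$ in an $R$-metric space is Cauchy if for every $\varepsilon\in R^{>0}$ there is $\gamma<\kappa$ with $d(x_i,x_j)<\varepsilon$ for all $\gamma<i,j<\kappa$; it converges to $x$ if for every $\varepsilon\in R^{>0}$ there is $\gamma<\kappa$ with $d(x_i,x)<\varepsilon$ for all $\gamma<i<\kappa$. An $R$-metric space is complete if every Cauchy $\kappa$-sequence in it converges. The same definitions apply with $S$ in place of $R$. $\overline X$ is the set of Cauchy $\kappa$-sequences in $X$ modulo the equivalence relation: $(a_i)\sim(b_i)$ iff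 for every $\varepsilon\in R^{>0}$ there is $\alpha<\kappa$ with $d(a_i,b_i)<\varepsilon$ for all $\alpha<i<\kappa$. One sets $\overline d([(a_i)],[(b_i)]):=\lim_{i\to\kappa}d(a_i,b_i)$, the limit being taken in $S$. An isometric embedding is a distance-preserving map. *)

(* Defs.v *)
From HB Require Import structures.
From mathcomp Require Import all_boot all_order all_algebra.
From mathcomp Require Import generic_quotient.
From mathcomp Require Import boolp classical_sets functions cardinality.
From mathcomp Require Import topology.

Set Implicit Arguments.
Unset Strict Implicit.
Unset Printing Implicit Defensive.

Import Order.TTheory GRing.Theory Num.Theory.
Local Open Scope classical_set_scope.
Local Open Scope card_scope.
Local Open Scope quotient_scope.
Local Open Scope ring_scope.

(* A ring morphism between real closed fields is automatically an embedding
   of ordered fields, since the nonnegative elements are exactly the squares. *)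
Definition dense_extension (R S : rcfType) (j : {rmorphism R -> S}) : Prop :=
  forall a b : S, a < b -> exists r : R, a < j r < b.

Definition dense_completion (R S : rcfType) (j : {rmorphism R -> S}) : Prop :=
  dense_extension j /\
  forall (T : rcfType) (g : {rmorphism R -> T}), dense_extension g ->
    exists h : {rmorphism T -> S}, h \o g =1 j /\
      forall h' : {rmorphism T -> S}, h' \o g =1 j -> h' =1 h.

Definition coinitial_pos (R : rcfType) (A : set R) : Prop :=
  A `<=` [set x | 0 < x] /\ forall e : R, 0 < e -> exists2 a, A a & a <= e.

(* The cardinal ci(R^{>0}) seen as an initial ordinal: a well-ordered type, none
   of whose proper initial segments has full cardinality, and whose cardinality
   is the least one of a coinitial subset of R^{>0}. Such a type is unique up to
   a unique order isomorphism. *)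
Record ci_ordinal (R : rcfType) := CiOrdinal {
  ci_disp : Order.disp_t ;
  ci_sort :> orderType ci_disp ;
  ci_wf : well_founded (fun i j : ci_sort => (i < j)%O) ;
  ci_initial : forall k : ci_sort,
    ~ ([set: ci_sort] #<= [set i : ci_sort | (i < k)%O]) ;
  ci_attained : exists2 A : set R, coinitial_pos A & [set: ci_sort] #= A ;
  ci_least : forall A : set R, coinitial_pos A -> [set: ci_sort] #<= A }.

Section Sequences.
Context {disp : Order.disp_t} (K : orderType disp).
Context {F : numDomainType} {M : metricType F}.

Definition kcauchy (u : K -> M) : Prop :=
  forall e : F, 0 < e -> exists g : K, forall i j : K,
    (g < i)%O -> (g < j)%O -> mdist (u i) (u j) < e.

Definition kcvg (u : K -> M) (x : M) : Prop :=
  forall e : F, 0 < e -> exists g : K, forall i : K,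
    (g < i)%O -> mdist (u i) x < e.

Definition kequiv (u v : K -> M) : Prop :=
  forall e : F, 0 < e -> exists g : K, forall i : K,
    (g < i)%O -> mdist (u i) (v i) < e.

End Sequences.

Definition kcomplete (disp : Order.disp_t) (K : orderType disp)
    (F : numDomainType) (M : metricType F) : Prop :=
  forall u : K -> M, kcauchy u -> exists x : M, kcvg u x.

Definition is_metric (F : numFieldType) (T : Type) (d : T -> T -> F) : Prop :=
  [/\ forall x y, 0 <= d x y,
      forall x y, d x y = 0 <-> x = y,
      forall x y, d x y = d y x &
      forall x y z, d x z <= d x y + d y z].

Section Metrized.
Context {F : numFieldType} {T : choiceType} {d : T -> T -> F}.

(* T, seen as a metric space (with its metric topology) for the distance d. *)
Definition metrized (hd : is_metric d) : Type := T.

Variable hd : is_metric d.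

HB.instance Definition _ := Choice.on (metrized hd).

Let dxx (x : metrized hd) : d x x = 0.
Proof. by have [_ h _ _] := hd; apply/h. Qed.

Let d_eq0 (x y : metrized hd) : d x y = 0 -> x = y.
Proof. by have [_ h _ _] := hd => /h. Qed.

Let d_sym (x y : metrized hd) : d x y = d y x.
Proof. by have [_ _ h _] := hd; apply: h. Qed.

Let d_triangle (y x z : metrized hd) : d x z <= d x y + d y z.
Proof. by have [_ _ _ h] := hd; apply: h. Qed.

HB.instance Definition _ :=
  isMetric.Build F (metrized hd) dxx d_eq0 d_sym d_triangle.

End Metrized.

Section Completion.
Context {R : rcfType} (K : ci_ordinal R) (X : metricType R).

Record cauchy_seq := CauchySeq {
  cseq :> K -> X ;
  cseq_cauchy : kcauchy cseq }.

HB.instance Definition _ := gen_eqMixin cauchy_seq.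
HB.instance Definition _ := gen_choiceMixin cauchy_seq.

Lemma ci_inhabited : exists i : K, True.
Proof.
have [A [_ /(_ 1 ltr01)[a Aa _]] KA] := ci_attained K.
apply: contrapT => K0.
have KE : [set: K] = set0 by rewrite -subset0 => i _; apply: K0; exists i.
by move: KA Aa; rewrite KE card_eq_sym card_eq0 => /eqP ->.
Qed.

Definition cequiv (a b : cauchy_seq) : bool := `[< kequiv a b >].

Lemma cequiv_refl : reflexive cequiv.
Proof.
have [k _] := ci_inhabited.
by move=> a; apply/asboolP => e e0; exists k => i _; rewrite mdistxx.
Qed.

Lemma cequiv_sym : symmetric cequiv.
Proof.
suff h a b : cequiv a b -> cequiv b a by move=> a b; apply/idP/idP; apply: h.
move=> /asboolP ab; apply/asboolP => e /ab[g hg].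
by exists g => i gi; rewrite metric_sym hg.
Qed.

Lemma cequiv_trans : transitive cequiv.
Proof.
move=> b a c /asboolP ab /asboolP bc; apply/asboolP => e e0.
have e20 : 0 < e / 2 by rewrite divr_gt0.
have [g hg] := ab _ e20; have [g' hg'] := bc _ e20.
exists (Order.max g g') => i; rewrite gt_max => /andP[gi g'i].
rewrite (le_lt_trans (metric_triangle _ (b i) _))//.
by rewrite [ltRHS]splitr ltrD ?hg ?hg'.
Qed.

Canonical cequiv_equiv :=
  EquivRel cequiv cequiv_refl cequiv_sym cequiv_trans.

Definition completion := {eq_quot cequiv}.

HB.instance Definition _ := Choice.on completion.
HB.instance Definition _ := EqQuotient.on completion.

Definition class (a : cauchy_seq) : completion := \pi_completion a.

Lemma const_kcauchy (x : X) : kcauchy (fun _ : K => x).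
Proof.
have [k _] := ci_inhabited.
by move=> e e0; exists k => i j _ _; rewrite mdistxx.
Qed.

Definition iota_completion (x : X) : completion :=
  class (CauchySeq (const_kcauchy x)).

Context {S : rcfType} (j : {rmorphism R -> S}).

(* S^o is S with the metric |x - y|. *)
Definition dist_seq (a b : cauchy_seq) : K -> S^o :=
  fun i => j (mdist (a i) (b i)).

(* A limit for chosen representatives, with a dummy value 0 if there is none. *)
Definition dbar (x y : completion) : S :=
  xget 0 [set l : S | kcvg (dist_seq (repr x) (repr y)) (l : S^o)].

End Completion.

(* Main.v *)
(** The heart of the matter is that every Cauchy [kappa]-sequence of [R]
    converges in [S]; the metric statements then follow by epsilon arguments
    and a diagonal sequence taken along [e : kappa -> R^{>0}] tending to [0].

    The Cauchy [kappa]-sequences of [R] modulo the null ones form an ordered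
    field [T] in which [R] is dense and Cauchy [kappa]-sequences of [R]
    converge. The universal property of [S] applies to [T] once [T] is known to
    be real closed. By induction on the degree, splitting off [gcd(p, p')], it
    is enough to find a root of [p] between two points of opposite signs when
    [p] is coprime to [p']. By Bezout, [|p'|] is bounded below where [|p|] is
    small, so around an approximate root [x0] in [R] there is an interval on
    which [p] still changes sign and [|p(y) - p(x)| >= c |y - x|]. Approximating
    [p] by polynomials over [R], which is real closed, gives points [x_i] of [R]
    in that interval with [|p(x_i)| < e_i]; they form a Cauchy sequence, and
    its limit is a root. *)

Require Import Defs.
From HB Require Import structures.
From mathcomp Require Import all_boot all_order all_algebra.
From mathcomp Require Import generic_quotient ring_quotient.
From mathcomp Require Import boolp classical_sets functions cardinality.
From mathcomp Require Import topology.
From mathcomp Require Import ring lra.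

Set Implicit Arguments.
Unset Strict Implicit.
Unset Printing Implicit Defensive.

Import Order.TTheory GRing.Theory Num.Theory.
Local Open Scope classical_set_scope.
Local Open Scope ring_scope.

(** * Polynomials over an ordered field *)

Lemma mul_gt0_close (F : realDomainType) (x y : F) : `|y - x| < `|x| -> 0 < x * y.
Proof.
rewrite ltr_norml; have [x0|x0|->] := ltgtP x 0.
- by rewrite ltr0_norm// => /andP[_ h]; rewrite nmulr_rgt0//; lra.
- by rewrite gtr0_norm// => /andP[h _]; rewrite pmulr_rgt0//; lra.
- by rewrite normr0 => /andP[]; lra.
Qed.

(** A perturbation smaller than the modulus keeps the sign, so a sign change of a polynomial
    survives small changes of the polynomial or of the endpoints. *)
Lemma mul_lt0_close (F : realFieldType) (x y x' y' : F) :
  `|x' - x| < `|x| -> `|y' - y| < `|y| -> x * y < 0 -> x' * y' < 0.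
Proof.
move=> /mul_gt0_close xx' /mul_gt0_close yy' xy.
have := mulr_gt0 xx' yy'.
by rewrite mulrACA nmulr_rgt0.
Qed.

Section PolynomialEstimates.
Variable F : realFieldType.
Implicit Types (p : {poly F}) (B : F).

Lemma horner_bounded p B : exists2 M, 0 < M &
  forall x, `|x| <= B -> `|p.[x]| <= M.
Proof.
elim/poly_ind: p => [|p c [M M0 hM]]; first by exists 1 => // x _; rewrite horner0 normr0.
have [B0|B0] := ltP B 0.
  by exists 1 => // x xB; have := normr_ge0 x; lra.
exists (M * B + `|c| + 1) => [|x xB].
  by have := normr_ge0 c; have := mulr_ge0 (ltW M0) B0; lra.
rewrite hornerMXaddC (le_trans (ler_normD _ _))// normrM.
have := ler_pM (normr_ge0 _) (normr_ge0 _) (hM x xB) xB; lra.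
Qed.

Lemma horner_lipschitz p B : exists2 L, 0 < L &
  forall x y, `|x| <= B -> `|y| <= B -> `|p.[y] - p.[x]| <= L * `|y - x|.
Proof.
elim/poly_ind: p => [|p c [L L0 hL]].
  by exists 1 => // x y _ _; rewrite !horner0 subrr normr0 mul1r.
have [B0|B0] := ltP B 0.
  by exists 1 => // x y xB; have := normr_ge0 x; lra.
have [M M0 hM] := horner_bounded p B.
exists (L * B + M) => [|x y xB yB].
  by have := mulr_ge0 (ltW L0) B0; lra.
rewrite !hornerMXaddC.
have -> : p.[y] * y + c - (p.[x] * x + c) =
    (p.[y] - p.[x]) * y + p.[x] * (y - x) by ring.
rewrite (le_trans (ler_normD _ _))// !normrM.
have := ler_pM (normr_ge0 _) (normr_ge0 _) (hL x y xB yB) yB.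
have := ler_wpM2r (normr_ge0 (y - x)) (hM x xB); lra.
Qed.

Lemma horner_taylor1 p B : exists2 M, 0 < M &
  forall x y, `|x| <= B -> `|y| <= B ->
    `|p.[y] - p.[x] - (y - x) * p^`().[x]| <= M * `|y - x| ^+ 2.
Proof.
elim/poly_ind: p => [|p c [M M0 hM]].
  exists 1 => // x y _ _; rewrite deriv0 !horner0 mulr0 !subrr normr0 mul1r.
  by rewrite exprn_ge0.
have [B0|B0] := ltP B 0.
  by exists 1 => // x y xB; have := normr_ge0 x; lra.
have [L L0 hL] := horner_lipschitz p B.
exists (M * B + L) => [|x y xB yB].
  by have := mulr_ge0 (ltW M0) B0; lra.
rewrite derivMXaddC hornerD hornerMX !hornerMXaddC.
(* The remainder for [p * 'X + c] is the remainder for [p] times [x], plus a term that the Lipschitz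
   bound makes quadratic in [y - x]. *)
have -> : p.[y] * y + c - (p.[x] * x + c) - (y - x) * (p.[x] + p^`().[x] * x) =
    (p.[y] - p.[x] - (y - x) * p^`().[x]) * x + (p.[y] - p.[x]) * (y - x) by ring.
rewrite (le_trans (ler_normD _ _))// !normrM.
have := ler_pM (normr_ge0 _) (normr_ge0 _) (hM x y xB yB) xB.
have := ler_wpM2r (normr_ge0 (y - x)) (hL x y xB yB); lra.
Qed.

(** Within distance [h] of [x0] the derivative moves by at most [L * h], and the second-order error
    is at most [2 * M * h * |y - x|]; hence [C = L + 2 * M]. *)
Lemma horner_expanding p B : exists2 C, 0 < C &
  forall x0 x y h d, `|x0| <= B -> `|x| <= B -> `|y| <= B ->
    `|x - x0| <= h -> `|y - x0| <= h -> d <= `|p^`().[x0]| ->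
    (d - C * h) * `|y - x| <= `|p.[y] - p.[x]|.
Proof.
have [L L0 hL] := horner_lipschitz p^`() B.
have [M M0 hM] := horner_taylor1 p B.
exists (L + 2 * M) => [|x0 x y h d x0B xB yB xx0 yx0 dx0].
  by rewrite addr_gt0// mulr_gt0.
have yx : `|y - x| <= 2 * h.
  by have := ler_distD x0 y x; rewrite (distrC x0); lra.
have d' : d - L * h <= `|p^`().[x]|.
  have := hL _ _ x0B xB; have := ler_wpM2l (ltW L0) xx0.
  have := lerB_dist p^`().[x0] p^`().[x]; rewrite distrC; lra.
have := hM _ _ xB yB.
have := ler_wpM2l (normr_ge0 (y - x)) d'.
have := ler_wpM2l (ltW M0) (ler_wpM2l (normr_ge0 (y - x)) yx).
have := lerB_dist ((y - x) * p^`().[x]) (p.[y] - p.[x]).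
rewrite distrC normrM -expr2; lra.
Qed.

(** The values at [x - h] and [x + h] have the signs of [- h * p'(x)] and [h * p'(x)]: [|p(x)|] is
    below [h * d / 2], and the factor 4 in the constant keeps the Taylor error within a quarter of
    [h * d]. *)
Lemma horner_sign_change p B : exists2 M, 0 < M &
  forall x h d, 0 < h -> `|x| <= B -> `|x - h| <= B -> `|x + h| <= B ->
    0 < d -> d <= `|p^`().[x]| -> M * h <= d -> `|p.[x]| < h * d / 2 ->
    p.[x - h] * p.[x + h] < 0.
Proof.
have [M M0 hM] := horner_taylor1 p B.
exists (4 * M) => [|x h d h0 xB xhB xhB' d0 dx Mh px]; first by rewrite mulr_gt0.
have close (s : F) : `|s| = h -> `|x + s| <= B ->
    `|p.[x + s] - s * p^`().[x]| < `|s * p^`().[x]|.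
  move=> sh sB.
  have -> : p.[x + s] - s * p^`().[x] =
     p.[x] + (p.[x + s] - p.[x] - (x + s - x) * p^`().[x]) by ring.
  apply: le_lt_trans (ler_normD _ _) _.
  have := hM _ _ xB sB; rewrite [X in _ <= _ * `|X| ^+ 2]addrAC subrr add0r sh.
  rewrite [`|s * _|]normrM sh.
  have := ler_wpM2l (ltW h0) dx; have := ler_wpM2l (ltW h0) Mh.
  have := mulr_gt0 h0 d0; lra.
have D0 : p^`().[x] != 0 by rewrite -normr_gt0 (lt_le_trans d0).
apply: (@mul_lt0_close _ (- h * p^`().[x]) (h * p^`().[x])).
- by apply: close; rewrite // normrN gtr0_norm.
- by apply: close; rewrite // gtr0_norm.
- by rewrite !mulNr oppr_lt0 -expr2 exprn_even_gt0//= mulf_neq0// gt_eqF.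
Qed.

(** In a Bezout identity [u p + v p' = 1], the bound [|p(x)| <= 1 / (2 U)] leaves at least [1 / 2]
    to [|v(x) p'(x)|], where [|u| <= U] and [|v| <= V]. *)
Lemma coprime_deriv_lower_bound p B : coprimep p p^`() ->
  exists2 c, 0 < c & exists2 d, 0 < d &
    forall x, `|x| <= B -> `|p.[x]| <= c -> d <= `|p^`().[x]|.
Proof.
move=> /Bezout_eq1_coprimepP[[u v]/= uv].
have [U U0 hU] := horner_bounded u B.
have [V V0 hV] := horner_bounded v B.
exists (2 * U)^-1; first by rewrite invr_gt0 mulr_gt0.
exists (2 * V)^-1 => [|x xB pU]; first by rewrite invr_gt0 mulr_gt0.
have := congr1 (horner^~ x) uv; rewrite hornerC hornerD !hornerM => uvx.
have : 1 <= `|u.[x] * p.[x]| + `|v.[x] * p^`().[x]|.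
  by rewrite (le_trans _ (ler_normD _ _))// uvx normr1.
rewrite !normrM.
have := ler_pM (normr_ge0 _) (normr_ge0 _) (hU x xB) pU.
have := ler_wpM2r (normr_ge0 p^`().[x]) (hV x xB).
rewrite invfM [2^-1 * _]mulrC mulrA divff ?gt_eqF// mul1r => h1 h2 h3.
by rewrite -[leLHS]mul1r ler_pdivrMr ?mulr_gt0//; lra.
Qed.

Lemma horner_close (p q : {poly F}) B e : 0 <= B -> 0 <= e ->
  (size q <= size p)%N -> (forall k, `|p`_k - q`_k| <= e) ->
  forall x, `|x| <= B ->
    `|p.[x] - q.[x]| <= e * \sum_(i < size p) B ^+ i.
Proof.
move=> B0 e0 qp pq x xB.
rewrite -hornerN -hornerD (@horner_coef_wide _ (size p)); last first.
  by rewrite (leq_trans (size_polyD _ _))// size_polyN geq_max leqnn.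
rewrite mulr_sumr (le_trans (ler_norm_sum _ _ _))// ler_sum// => i _.
by rewrite coefB normrM ler_pM// normrX lerXn2r// nnegrE.
Qed.

End PolynomialEstimates.

(** * Real closedness of a complete dense extension *)

Lemma poly_ivt_mul (R : rcfType) (p : {poly R}) (a b : R) :
  a <= b -> p.[a] * p.[b] <= 0 -> exists2 x, a <= x <= b & root p x.
Proof.
move=> ab; have [pa|pa] := leP p.[a] 0; have [pb|pb] := leP 0 p.[b].
- by move=> _; apply: poly_ivt => //; rewrite pa.
- move=> h; exists a; rewrite ?lexx//; apply/rootP/eqP.
  by move: h; rewrite nmulr_lle0// => h; rewrite eq_le pa.
- move=> h; exists b; rewrite ?lexx ?ab//; apply/rootP/eqP.
  by move: h; rewrite pmulr_rle0// => h; rewrite eq_le pb h.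
- move=> _; have [x xab] : exists2 x, a <= x <= b & root (- p) x.
    by apply: poly_ivt => //; rewrite !hornerN; lra.
  by rewrite rootN; exists x.
Qed.

(** * Morphisms from a real closed field preserve the order *)

Section RcfMorphism.
Variables (R : rcfType) (F : realFieldType) (g : {rmorphism R -> F}).

(** Nonnegative elements of [R] are squares, and squares go to squares. *)
Lemma rcf_rmorph_le : {mono g : x y / x <= y}.
Proof.
have ge0 x : 0 <= x -> 0 <= g x.
  by move=> x0; rewrite -(sqr_sqrtr x0) rmorphXn sqr_ge0.
apply: le_mono => x y xy; rewrite lt_neqAle fmorph_eq.
by rewrite lt_eqF//= -subr_ge0 -rmorphB ge0// subr_ge0 ltW.
Qed.

Lemma rcf_rmorph_lt : {mono g : x y / x < y}.
Proof. exact: leW_mono rcf_rmorph_le. Qed.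

Lemma rcf_rmorph_gt0 x : (0 < g x) = (0 < x).
Proof. by rewrite -(rmorph0 g) rcf_rmorph_lt. Qed.

Lemma rcf_rmorph_norm x : g `|x| = `|g x|.
Proof.
have [x0|x0] := leP 0 x; first by rewrite !ger0_norm// -(rmorph0 g) rcf_rmorph_le.
by rewrite !ltr0_norm ?rmorphN// -(rmorph0 g) rcf_rmorph_lt.
Qed.

End RcfMorphism.

(** * Approximate roots and sign changes along a dense real closed subfield *)

Section DenseRcf.
Variables (R : rcfType) (T : realFieldType) (g : {rmorphism R -> T}).
Hypothesis gdense : forall a b : T, a < b -> exists r : R, a < g r < b.

Lemma dense_gt0 (e : T) : 0 < e -> exists2 r : R, 0 < r & g r < e.
Proof.
by move=> /gdense[r /andP[r0 re]]; exists r => //; rewrite -(rcf_rmorph_gt0 g).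
Qed.

(** The coefficients of [p] are approximated by elements of [R]; the resulting polynomial over [R]
    still changes sign, so it has an exact root, where [p] is small. *)
Lemma approx_root (p : {poly T}) (a b : R) (e : T) :
  a <= b -> p.[g a] * p.[g b] < 0 -> 0 < e ->
  exists2 x, a <= x <= b & `|p.[g x]| < e.
Proof.
move=> ab pab e0.
have pa0 : 0 < `|p.[g a]|.
  by rewrite normr_gt0; apply: contraTN pab => /eqP->; rewrite mul0r ltxx.
have pb0 : 0 < `|p.[g b]|.
  by rewrite normr_gt0; apply: contraTN pab => /eqP->; rewrite mulr0 ltxx.
(* The bound [e] serves the conclusion; the two endpoint values ensure that the approximating
   polynomial keeps the signs at [a] and [b]. *)
pose d := Num.min e (Num.min `|p.[g a]| `|p.[g b]|).
have d0 : 0 < d by rewrite !lt_min e0 pa0.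
pose B := `|g a| + `|g b|.
have B0 : 0 <= B by rewrite addr_ge0.
pose s := \sum_(i < size p) B ^+ i.
have s0 : 0 <= s by rewrite sumr_ge0// => i _; rewrite exprn_ge0.
(* Tolerance on each coefficient: an error [t] per coefficient costs at most [t * s < d] in
   value. *)
pose t := d / (s + 1).
have t0 : 0 < t by rewrite divr_gt0//; lra.
have ts : t * s < d.
  by rewrite /t mulrAC ltr_pdivrMr; [rewrite ltr_pM2l//; lra|lra].
have /choice[r hr] : forall k, exists r, `|p`_k - g r| <= t.
  move=> k.
  have [r hr] : exists r, p`_k - t < g r < p`_k + t by apply: gdense; lra.
  by exists r; rewrite ler_norml; lra.
pose q := \poly_(k < size p) r k.
have pq x : a <= x <= b -> `|p.[g x] - g q.[x]| < d.
  move=> xab; apply: le_lt_trans ts; rewrite -horner_map/=.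
  apply: horner_close => //; first exact: ltW.
  - by rewrite size_map_poly size_poly.
  - move=> k; rewrite coef_map coef_poly/=; case: ltnP => [//|pk].
    by rewrite rmorph0 subr0 nth_default// normr0 ltW.
  have /andP[] : g a <= g x <= g b by rewrite !rcf_rmorph_le.
  have := ler_norm (g b); have := lerNnormlW (lexx `|g a|).
  by have := normr_ge0 (g a); have := normr_ge0 (g b); rewrite ler_norml /B; lra.
have [x xab /rootP qx] : exists2 x, a <= x <= b & root q x.
  apply: poly_ivt_mul => //; rewrite -(rcf_rmorph_le g) rmorphM rmorph0 ltW//.
  apply: mul_lt0_close pab; rewrite distrC.
  - by apply: (lt_le_trans (pq _ _)); rewrite ?lexx// !ge_min lexx ?orbT.
  - by apply: (lt_le_trans (pq _ _)); rewrite ?lexx ?andbT// !ge_min lexx ?orbT.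
exists x => //.
have := pq x xab; rewrite qx rmorph0 subr0 => /lt_le_trans; apply.
by rewrite ge_min lexx.
Qed.

Lemma dense_sign_change (p : {poly T}) (a b : T) : a <= b -> p.[a] * p.[b] < 0 ->
  exists a' b' : R, [/\ a <= g a', a' <= b', g b' <= b & p.[g a'] * p.[g b'] < 0].
Proof.
rewrite le_eqVlt => /predU1P[-> /(le_lt_trans (sqr_ge0 _))|ab pab]; first by rewrite ltxx.
have pa0 : 0 < `|p.[a]|.
  by rewrite normr_gt0; apply: contraTN pab => /eqP->; rewrite mul0r ltxx.
have pb0 : 0 < `|p.[b]|.
  by rewrite normr_gt0; apply: contraTN pab => /eqP->; rewrite mulr0 ltxx.
have [L L0 hL] := horner_lipschitz p (`|a| + `|b|).
have B x : a <= x <= b -> `|x| <= `|a| + `|b|.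
  have := ler_norm b; have := lerNnormlW (lexx `|a|).
  by have := normr_ge0 a; have := normr_ge0 b; rewrite ler_norml; lra.
(* Within [|p(a)| / L] of [a] the sign of [p] persists; staying on its own side of the midpoint
   gives [a' <= b']. *)
have [a' /andP[a'1]] : exists a', a < g a' < Num.min (a + `|p.[a]| / L) ((a + b) / 2).
  by apply: gdense; rewrite lt_min ltrDl divr_gt0//=; lra.
rewrite lt_min => /andP[a'2 a'3].
have [b' /andP[]] : exists b', Num.max (b - `|p.[b]| / L) ((a + b) / 2) < g b' < b.
  by apply: gdense; rewrite gt_max ltrBlDr ltrDl divr_gt0//=; lra.
rewrite gt_max => /andP[b'1 b'2] b'3.
exists a', b'; split; [exact: ltW| |exact: ltW|].
  by rewrite -(rcf_rmorph_le g); lra.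
apply: mul_lt0_close pab.
- apply: (le_lt_trans (hL _ _ _ _)); [apply: B; lra|apply: B; lra|].
  by rewrite mulrC -ltr_pdivlMr// ltr_norml; have := divr_gt0 pa0 L0; lra.
- apply: (le_lt_trans (hL _ _ _ _)); [apply: B; lra|apply: B; lra|].
  by rewrite mulrC -ltr_pdivlMr// ltr_norml; have := divr_gt0 pb0 L0; lra.
Qed.

End DenseRcf.

(** * Intermediate values in a dense extension where Cauchy sequences of [R] converge *)

Section RealClosed.
Variables (R : rcfType) (T : realFieldType) (g : {rmorphism R -> T}).
Hypothesis gdense : forall a b : T, a < b -> exists r : R, a < g r < b.
Variables (disp : Order.disp_t) (K : orderType disp) (e : K -> R).
Hypothesis nomax : forall k : K, exists k' : K, (k < k')%O.
Hypothesis e_gt0 : forall k, 0 < e k.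
Hypothesis e_vanish : kcvg (e : K -> R^o) (0 : R^o).
Hypothesis gcomplete : forall u : K -> R^o, kcauchy u ->
  exists x : T^o, kcvg (g \o u : K -> T^o) x.

(** The lower bound makes points with [|p| < e i] a Cauchy sequence; the upper bound is the
    continuity that makes [p] vanish at its limit. *)
Lemma separated_approx_root (p : {poly T}) (a b : R) (d L : T) :
  a <= b -> p.[g a] * p.[g b] < 0 -> 0 < d -> 0 < L ->
  (forall x y, g a <= x <= g b -> g a <= y <= g b ->
     d * `|y - x| <= `|p.[y] - p.[x]| <= L * `|y - x|) ->
  exists2 x, g a <= x <= g b & root p x.
Proof.
move=> ab pab d0 L0 hdL.
have /choice[x hx] : forall i, exists x, a <= x <= b /\ `|p.[g x]| < g (e i).
  move=> i; have ei : 0 < g (e i) by rewrite rcf_rmorph_gt0.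
  by have [x xab px] := approx_root gdense ab pab ei; exists x.
have gx i : g a <= g (x i) <= g b.
  by have [xab _] := hx i; rewrite !rcf_rmorph_le.
have xcauchy : kcauchy (x : K -> R^o).
  move=> t t0; have [r r0 rt] : exists2 r : R, 0 < r & g r < d * g t / 2.
    by apply: (dense_gt0 gdense); rewrite divr_gt0 ?mulr_gt0 ?rcf_rmorph_gt0.
  have [k hk] := e_vanish r0; exists k => i j ki kj.
  rewrite /mdist/= -(rcf_rmorph_lt g) rcf_rmorph_norm rmorphB.
  rewrite -(ltr_pM2l d0).
  have /andP[/le_lt_trans-> //] := hdL _ _ (gx i) (gx j).
  have er l : (k < l)%O -> `|p.[g (x l)]| < g r.
    move=> kl; have [_ /lt_trans->//] := hx l.
    have := hk _ kl; rewrite /mdist/= sub0r normrN gtr0_norm//.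
    by rewrite rcf_rmorph_lt.
  have := er _ ki; have := er _ kj => pj pi.
  by apply: le_lt_trans (ler_normB _ _) _; lra.
have [z hz] : exists z : T, forall t, 0 < t ->
    exists k, forall i, (k < i)%O -> `|z - g (x i)| < t := gcomplete xcauchy.
(* One index serves both approximations, because [K] has no largest element. *)
have zlim t : 0 < t -> exists i, `|z - g (x i)| < t /\ g (e i) < t.
  move=> t0; have [k hk] := hz _ t0.
  have [r r0 rt] := dense_gt0 gdense t0.
  have [k' hk'] := e_vanish r0.
  have [i] := nomax (Order.max k k'); rewrite gt_max => /andP[ki k'i].
  exists i; split; first exact: hk.
  apply: lt_trans rt; rewrite rcf_rmorph_lt.
  by have := hk' _ k'i; rewrite /mdist/= sub0r normrN gtr0_norm.
have zab : g a <= z <= g b.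
  apply/andP; split; rewrite leNgt; apply/negP => h.
  - have [|i [+ _]] := zlim (g a - z); first by rewrite subr_gt0.
    by rewrite ltr_norml; have := gx i; lra.
  - have [|i [+ _]] := zlim (z - g b); first by rewrite subr_gt0.
    by rewrite ltr_norml; have := gx i; lra.
exists z => //; apply/rootP/eqP; rewrite -normr_le0 leNgt; apply/negP => pz.
(* With this threshold [t], [|p(z)|] would be less than [L * t + t], which is [|p(z)|] itself. *)
have t0 : 0 < `|p.[z]| / (L + 1) by rewrite divr_gt0//; lra.
have [i [zi ei]] := zlim _ t0.
have /andP[_ h] := hdL _ _ (gx i) zab.
have [_ pxi] := hx i.
move: zi ei; rewrite !ltr_pdivlMr ?addr_gt0// => zi ei.
have := ler_distD 0 p.[z] p.[g (x i)]; rewrite subr0 sub0r normrN.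
have := lerB_normD p.[z] (- p.[g (x i)]); rewrite normrN.
have L1 : 0 < L + 1 by lra.
have : L * `|z - g (x i)| + `|p.[g (x i)]| < `|p.[z]|.
  rewrite -(ltr_pM2r L1).
  have := ltr_pM2l L0 (`|z - g (x i)| * (L + 1)) `|p.[z]|; rewrite zi.
  have : `|p.[g (x i)]| * (L + 1) < `|p.[z]|.
    by apply: le_lt_trans ei; rewrite ler_pM2r// ltW.
  by lra.
lra.
Qed.

Lemma poly_ivt_coprime (p : {poly T}) (a b : T) : coprimep p p^`() ->
  a <= b -> p.[a] * p.[b] <= 0 -> exists2 x, a <= x <= b & root p x.
Proof.
move=> cop ab.
have [pa|pa] := eqVneq p.[a] 0.
  by exists a; [rewrite lexx|apply/rootP].
have [pb|pb] := eqVneq p.[b] 0.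
  by exists b; [rewrite lexx ab|apply/rootP].
rewrite le_eqVlt mulf_eq0 (negbTE pa) (negbTE pb)/= => pab.
have [a' [b' [aa' ab' bb' pab']]] := dense_sign_change gdense ab pab.
have {}pa : 0 < `|p.[a]| by rewrite normr_gt0.
have {}pb : 0 < `|p.[b]| by rewrite normr_gt0.
(* The extra 1 leaves room for an interval around [x0] that sticks out of the segment from [a] to
   [b]. *)
pose B := `|a| + `|b| + 1.
have BP x : a - 1 <= x <= b + 1 -> `|x| <= B.
  have := ler_norm b; have := lerNnormlW (lexx `|a|).
  by have := normr_ge0 a; have := normr_ge0 b; rewrite ler_norml /B; lra.
have aB : `|a| <= B by apply: BP; lra.
have bB : `|b| <= B by apply: BP; lra.
have [L L0 hL] := horner_lipschitz p B.
have [C C0 hC] := horner_expanding p B.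
have [M M0 hM] := horner_sign_change p B.
have [c c0 [d d0 hd]] := coprime_deriv_lower_bound B cop.
(* In order, the bounds on [h] keep the interval within [B], keep the expansion factor at least
   [d / 2], allow the sign change at [x0 - h] and [x0 + h], and prevent the root from passing [a] or
   [b]. *)
have [h h0 hlt] : exists2 h : R, 0 < h & g h <
    Num.min (Num.min (Num.min 1 (d / 2 / C)) (d / M))
            (Num.min (`|p.[a]| / L) (`|p.[b]| / L)).
  by apply: (dense_gt0 gdense); rewrite !lt_min ltr01 !divr_gt0.
move: hlt; rewrite !lt_min -!andbA => /and5P[h1 hdC hdM ha hb].
have gh0 : 0 < g h by rewrite rcf_rmorph_gt0.
have [x0 /andP[ax0 x0b]] : exists2 x, a' <= x <= b' &
    `|p.[g x]| < Num.min c (g h * d / 2).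
  by apply: (approx_root gdense); rewrite // lt_min c0 divr_gt0 ?mulr_gt0.
rewrite lt_min => /andP[/ltW pc ph].
have gx0 : a <= g x0 <= b.
  by rewrite (le_trans aa') ?rcf_rmorph_le// (le_trans _ bb')// rcf_rmorph_le.
have IB x : g (x0 - h) <= x <= g (x0 + h) -> `|x| <= B /\ `|x - g x0| <= g h.
  rewrite rmorphB rmorphD => xI; split; first by apply: BP; lra.
  by rewrite ler_norml; lra.
have x0B : `|g x0| <= B by apply: BP; lra.
have dx0 := hd _ x0B pc.
have x0hh : x0 - h <= x0 + h by lra.
have sc : p.[g (x0 - h)] * p.[g (x0 + h)] < 0.
  rewrite rmorphB rmorphD; apply: (hM _ _ d) => //.
  - by apply: BP; lra.
  - by apply: BP; lra.
  - by rewrite mulrC -ler_pdivlMr// ltW.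
have d20 : 0 < d / 2 by rewrite divr_gt0.
have [|z zI rz] := @separated_approx_root p _ _ (d / 2) L x0hh sc d20 L0.
  move=> x y /IB[xB xx0] /IB[yB yx0]; rewrite hL// andbT.
  apply: le_trans (hC _ _ _ _ _ x0B xB yB xx0 yx0 dx0).
  rewrite ler_wpM2r//; move: hdC; rewrite ltr_pdivlMr//; lra.
have [zB] := IB _ zI; rewrite ler_norml => zx0.
exists z => //.
(* A root beyond an endpoint would be within [g h] of it, and the Lipschitz bound would make [p] too
   small there. *)
apply/andP; split; rewrite leNgt; apply/negP => zlt.
- have := hL _ _ zB aB; rewrite (rootP rz) subr0 leNgt => /negP; apply.
  rewrite mulrC -ltr_pdivlMr//; apply: le_lt_trans ha.
  by rewrite ger0_norm; lra.
- have := hL _ _ zB bB; rewrite (rootP rz) subr0 leNgt => /negP; apply.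
  rewrite mulrC -ltr_pdivlMr//; apply: le_lt_trans hb.
  by rewrite ler0_norm; lra.
Qed.

Lemma dense_complete_ivt (p : {poly T}) (a b : T) :
  a <= b -> p.[a] * p.[b] <= 0 -> exists2 x, a <= x <= b & root p x.
Proof.
move=> ab; have [n] := ubnP (size p).
elim: n p => // n IH p /ltnSE pn pab.
have [p0|p0] := eqVneq p 0; first by exists a; rewrite ?lexx// p0 root0.
have [|ncop] := boolP (coprimep p p^`()); first by move=> /poly_ivt_coprime; apply.
pose d := gcdp p p^`(); pose q := p %/ d.
have pE : p = q * d by rewrite divpK// dvdp_gcdl.
have q0 : q != 0 by apply: contraNneq p0 => q0; rewrite pE q0 mul0r.
have d0 : d != 0 by apply: contraNneq p0 => d0; rewrite pE d0 mulr0.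
have dp : (1 < size d)%N by rewrite ltn_neqAle eq_sym ncop size_poly_gt0.
have sp : size p = (size q + size d).-1 by rewrite {1}pE size_mul.
have dn : (size d < n)%N.
  (* A zero derivative makes [p] constant, and a constant whose square is nonpositive is zero. *)
  have [p'0|p'0] := eqVneq p^`() 0.
    have pC : p = (p`_0)%:P.
      apply/polyP => -[|k]; rewrite coefC//=.
      have := congr1 (fun r : {poly T} => r`_k) p'0.
      by rewrite /= coef_deriv coef0 => /eqP; rewrite mulrn_eq0/= => /eqP.
    move: pab; rewrite pC !hornerC -expr2 => c0.
    have : p`_0 == 0 by rewrite -sqrf_eq0 eq_le c0 sqr_ge0.
    by move=> /eqP c00; move: p0; rewrite pC c00 eqxx.
  apply: leq_trans pn; apply: leq_ltn_trans (lt_size_deriv p0).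
  by apply: dvdp_leq => //; apply: dvdp_gcdr.
have qn : (size q < n)%N.
  apply: leq_trans pn; rewrite sp; move: dp; case: (size d) => [|[|m]]// _.
  by rewrite !addnS/= ltnS leq_addr.
have : q.[a] * q.[b] <= 0 \/ d.[a] * d.[b] <= 0.
  move: pab; rewrite {1 2}pE !hornerM mulrACA.
  have [|h1] := leP (q.[a] * q.[b]) 0; first by left.
  by rewrite pmulr_rle0//; right.
case=> /IH[]// x xab rx; exists x => //; rewrite pE rootM rx ?orbT//.
Qed.
End RealClosed.

(** * The ordinal ci(R^{>0}) *)

Section CoinitialOrdinal.
Variables (R : rcfType) (K : ci_ordinal R).

Lemma ci_enumeration : exists2 f : K -> R, injective f & coinitial_pos (range f).
Proof.
have [A Aci] := ci_attained K.
move=> /(@card_set_bijP _ R^o)[f [fA finj fsurj]]; exists f => [x y|].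
  by apply: finj; rewrite inE.
by rewrite (_ : range f = A)//; apply/seteqP; split=> [_ [i _ <-]|//]; apply: fA.
Qed.

(** A coinitial set is at least as large as [K], which does not inject into a proper initial
    segment. *)
Lemma coinitial_pos_small (A : set R) (k : K) :
  coinitial_pos A -> ~ (A #<= [set i : K | (i < k)%O])%card.
Proof.
move=> Aci Ak; apply: (@ci_initial _ K k).
exact: card_le_trans (ci_least K Aci) Ak.
Qed.

(* Removing one point from a coinitial set leaves it coinitial. *)
Lemma ci_unbounded (k : K) : exists k' : K, (k < k')%O.
Proof.
apply: contrapT => kmax.
have {}kmax i : i != k -> (i < k)%O.
  by move=> ik; rewrite lt_neqAle ik leNgt; apply/negP => ki; apply: kmax; exists i.
have [f finj [f0 fci]] := ci_enumeration.
apply: (@coinitial_pos_small (f @` [set i | (i < k)%O]) k); last exact: card_image_le.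
split=> [_ [i _ <-]|e e0]; first by apply: f0; exists i.
have fk0 : 0 < f k by apply: f0; exists k.
(* Halving [f k] forces the element found to differ from the removed point. *)
have [|_ [i _ <-]] := fci (Num.min e (f k / 2)); first by rewrite lt_min e0 divr_gt0.
rewrite le_min => /andP[fie fik]; exists (f i) => //; exists i => //=.
by apply: kmax; apply: contraTneq fik => ->; rewrite -ltNge ltr_pdivrMr// mulr_natr mulr2n ltrDl.
Qed.

(* The initial segments of [K] are too small to index a coinitial set, so below
   the enumerated values up to [i] there is room for a positive [e i]. *)
Lemma ci_vanishing : exists2 e : K -> R,
  forall i, 0 < e i & kcvg (e : K -> R^o) (0 : R^o).
Proof.
have [f _ [f0 fci]] := ci_enumeration.
have /choice[e he] : forall i, exists e, 0 < e /\ forall k, (k <= i)%O -> e < f k.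
  move=> i; apply: contrapT => small.
  have [i' ii'] := ci_unbounded i.
  apply: (@coinitial_pos_small (f @` [set k | (k <= i)%O]) i').
    split=> [_ [k _ <-]|t t0]; first by apply: f0; exists k.
    apply: contrapT => tsmall; apply: small; exists t; split=> // k ki.
    by rewrite ltNge; apply/negP => fkt; apply: tsmall; exists (f k) => //; exists k.
  apply: card_le_trans (card_image_le _ _) _; apply: subset_card_le => k /=.
  by move=> /le_lt_trans; apply.
exists e => [i|t t0]; first by have [] := he i.
have [_ [k _ <-] fkt] := fci t t0; exists k => i ki.
have [ei0 efk] := he i; rewrite /mdist/= sub0r normrN gtr0_norm//.
by rewrite (lt_le_trans _ fkt)// efk// ltW.
Qed.

End CoinitialOrdinal.

(** * The completion of a real closed field *)

(** Convergence and equivalence of sequences unfold to membership in this filter, so thresholds can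
    be combined by the near tactics. *)
Definition tails (disp : Order.disp_t) (K : orderType disp) : set_system K :=
  [set P | exists k, forall i, (k < i)%O -> P i].
Arguments tails {disp} K _.

#[export] Instance tails_filter (R : rcfType) (K : ci_ordinal R) :
  ProperFilter (tails K).
Proof.
apply: Build_ProperFilter_ex => [P [k kP]|].
  by have [i ki] := ci_unbounded k; exists i; apply: kP.
split=> [|P Q [k kP] [l lQ]|P Q PQ [k kP]].
- by have [k _] := ci_inhabited K; exists k.
- exists (Order.max k l) => i; rewrite gt_max => /andP[ki li].
  by split; [apply: kP|apply: lQ].
- by exists k => i /kP; apply: PQ.
Qed.

(** A centre [c] replaces the second index, leaving a single running index for the filter; a late
    term of the sequence serves as centre. *)
Lemma kcauchyP (R : rcfType) (K : ci_ordinal R) (F : realFieldType)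
    (M : metricType F) (u : K -> M) :
  kcauchy u <-> forall e : F, 0 < e ->
    exists c, \forall i \near tails K, mdist (u i) c < e.
Proof.
split=> [uC e e0|uC e e0].
  have [k hk] := uC e e0; have [l kl] := ci_unbounded k.
  by exists (u l); exists k => i ki; apply: hk.
have [|c [k hk]] := uC (e / 2); first by rewrite divr_gt0.
exists k => i l ki kl; rewrite (le_lt_trans (metric_triangle _ c _))//.
by rewrite (metric_sym c) [ltRHS]splitr ltrD ?hk.
Qed.

(** * The ring of Cauchy sequences of [R] and its ideal of null sequences *)

Section CauchyRing.
Variables (R : rcfType) (K : ci_ordinal R).
Implicit Types u v : K -> R.

Definition cauchyb : {pred K -> R} := fun u => `[< kcauchy (u : K -> R^o) >].

Lemma cauchybP u : reflect
  (forall e, 0 < e -> exists c, \forall i \near tails K, `|u i - c| < e)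
  (u \in cauchyb).
Proof.
apply: (iffP (asboolP _)) => [/kcauchyP uC e /uC[c uc]|uC].
  by exists c; near do rewrite distrC.
by apply/(@kcauchyP R K R R^o) => e /uC[c uc]; exists c; near do rewrite /mdist/= distrC.
Unshelve. all: end_near. Qed.

Lemma cauchyb_bounded u : u \in cauchyb ->
  exists2 M, 0 < M & \forall i \near tails K, `|u i| <= M.
Proof.
move=> /cauchybP/(_ 1 ltr01)[c uc]; exists (`|c| + 1).
  by have := normr_ge0 c; lra.
near=> i; have : `|u i - c| < 1 by near: i.
by have := ler_distD c (u i) 0; rewrite !subr0; lra.
Unshelve. all: end_near. Qed.

Lemma cauchyb_cst (r : R) : (fun=> r) \in cauchyb.
Proof. by apply/cauchybP => e e0; exists r; near=> i; rewrite subrr normr0.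
Unshelve. all: end_near. Qed.

Lemma cauchyb_norm u : u \in cauchyb -> (fun i => `|u i|) \in cauchyb.
Proof.
move=> /cauchybP uC; apply/cauchybP => e /uC[c uc]; exists `|c|.
by near do apply: le_lt_trans (ler_dist_dist _ _) _.
Unshelve. all: end_near. Qed.

Lemma cauchyb_subring : subring_closed cauchyb.
Proof.
split=> [|u v /cauchybP uC /cauchybP vC|u v uC vC]; first exact: cauchyb_cst.
  apply/cauchybP => e e0; have e20 : 0 < e / 2 by rewrite divr_gt0.
  have [c uc] := uC _ e20; have [d vd] := vC _ e20; exists (c - d).
  near=> i; have : `|u i - c| < e / 2 by near: i.
  have : `|v i - d| < e / 2 by near: i.
  change ((u - v) i) with (u i - v i).
  by rewrite !ltr_norml => /andP[? ?] /andP[? ?]; lra.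
have [M M0 uM] := cauchyb_bounded uC.
move: uC vC => /cauchybP uC /cauchybP vC.
apply/cauchybP => e e0.
have [|d vd] := vC (e / 2 / M); first by rewrite !divr_gt0.
(* Adding 1 allows division even when the centre [d] is 0. *)
have d0 : 0 < `|d| + 1 by have := normr_ge0 d; lra.
have [|c uc] := uC (e / 2 / (`|d| + 1)); first by rewrite !divr_gt0.
exists (c * d); near=> i.
have uMi : `|u i| <= M by near: i.
have : `|u i - c| < e / 2 / (`|d| + 1) by near: i.
have : `|v i - d| < e / 2 / M by near: i.
change ((u * v) i) with (u i * v i).
rewrite !ltr_pdivlMr// => h1 h2.
have -> : u i * v i - c * d = u i * (v i - d) + (u i - c) * d by ring.
apply: le_lt_trans (ler_normD _ _) _; rewrite !normrM.
have := ler_wpM2r (normr_ge0 (v i - d)) uMi.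
have := normr_ge0 (u i - c).
by lra.
Unshelve. all: end_near. Qed.

HB.instance Definition _ := GRing.isSubringClosed.Build (K -> R) cauchyb
  cauchyb_subring.

Definition cauchy_ring := {u : K -> R | u \in cauchyb}.
HB.instance Definition _ := SubChoice.on cauchy_ring.
Definition cauchy_elt u (uC : u \in cauchyb) : cauchy_ring := exist _ u uC.
HB.instance Definition _ := 
  GRing.SubChoice_isSubComPzRing.Build _ _ cauchy_ring cauchyb_subring.

Lemma cauchy_ring_nonzero : 1 != 0 :> cauchy_ring.
Proof.
apply/eqP => /(congr1 val) h; have [k _] := ci_inhabited K.
by have /eqP := congr1 (fun u : K -> R => u k) h; rewrite oner_eq0.
Qed.
HB.instance Definition _ :=
  GRing.PzSemiRing_isNonZero.Build cauchy_ring cauchy_ring_nonzero.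

Implicit Types x y : cauchy_ring.

Definition nullb : {pred cauchy_ring} :=
  fun x => `[< kcvg (val x : K -> R^o) (0 : R^o) >].

Lemma nullbP x : reflect
  (forall e, 0 < e -> \forall i \near tails K, `|val x i| < e) (x \in nullb).
Proof.
by apply: (iffP (asboolP _)) => xN e /xN; apply: filterS => i; rewrite /mdist/= sub0r normrN.
Qed.

Lemma nullb_ideal : idealr_closed nullb.
Proof.
split.
- by apply/nullbP => e e0; near=> i; rewrite normr0.
- apply/nullbP => /(_ 1 ltr01) h; have [i /=] := filter_ex h.
  by rewrite normr1 ltxx.
- move=> a x y /nullbP xN /nullbP yN; apply/nullbP => e e0.
  have [M M0 aM] := cauchyb_bounded (valP a).
  near=> i.
  have aMi : `|val a i| <= M by near: i.
  have : `|val x i| < e / 2 / M by near: i; apply: xN; rewrite !divr_gt0.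
  have : `|val y i| < e / 2 by near: i; apply: yN; rewrite divr_gt0.
  change (val (a * x + y) i) with (val a i * val x i + val y i).
  move=> h1; rewrite ltr_pdivlMr// => h2; apply: le_lt_trans (ler_normD _ _) _.
  rewrite normrM; have := ler_wpM2r (normr_ge0 (val x i)) aMi.
  by lra.
Unshelve. all: end_near. Qed.

HB.instance Definition _ := isIdealr.Build cauchy_ring nullb nullb_ideal.

End CauchyRing.
Arguments cauchyb {R} K _.
Arguments nullb {R} K _.

(** * Cauchy sequences modulo null sequences as an ordered field *)

Definition field_completion (R : rcfType) (K : ci_ordinal R) :=
  {ideal_quot (nullb K)}.

HB.instance Definition _ (R : rcfType) (K : ci_ordinal R) :=
  GRing.ComNzRing.on (field_completion K).
HB.instance Definition _ (R : rcfType) (K : ci_ordinal R) :=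
  EqQuotient.on (field_completion K).

Section FieldCompletion.
Variables (R : rcfType) (K : ci_ordinal R).
Local Notation T := (field_completion K).
Local Notation C := (cauchy_ring K).
Implicit Types (x y : T) (u v : C).

Definition field_class (u : C) : T := (\pi_T u)%qT.

Lemma field_class_zmod : zmod_morphism field_class.
Proof. by move=> u v; apply: (rmorphB (\pi_{ideal_quot (nullb K)})%qT). Qed.

Lemma field_class_monoid : monoid_morphism field_class.
Proof.
split; first exact: (rmorph1 (\pi_{ideal_quot (nullb K)})%qT).
by move=> u v; apply: (rmorphM (\pi_{ideal_quot (nullb K)})%qT).
Qed.

HB.instance Definition _ :=
  GRing.isZmodMorphism.Build C T field_class field_class_zmod.
HB.instance Definition _ :=
  GRing.isMonoidMorphism.Build C T field_class field_class_monoid.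

Lemma field_class_eq0 u : (field_class u == 0) = (u \in nullb K).
Proof.
rewrite -(rmorph0 field_class) /field_class.
by have := Quotient.idealrBE (nullb K) u 0; rewrite subr0 => ->.
Qed.

Lemma field_class_surj x : exists u, x = field_class u.
Proof. by exists (repr x); rewrite /field_class reprK. Qed.

Lemma field_class_near_eq u v : (\forall i \near tails K, val u i = val v i) ->
  field_class u = field_class v.
Proof.
move=> uv; apply/eqP; rewrite -subr_eq0 -rmorphB field_class_eq0.
apply/nullbP => e e0; near=> i; rewrite rmorphB/=.
by change (`|val u i - val v i| < e); rewrite (near uv i)// subrr normr0.
Unshelve. all: end_near. Qed.

Lemma field_class_neq0 u : field_class u != 0 ->
  exists2 d, 0 < d & (\forall i \near tails K, d <= val u i) \/
                     (\forall i \near tails K, val u i <= - d).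
Proof.
rewrite field_class_eq0 => /nullbP/existsNP[e /not_implyP[e0 unull]].
have e30 : 0 < e / 3 by rewrite divr_gt0.
have [c uc] := cauchybP _ (valP u) _ e30.
exists (e / 3) => //.
(* A tail lies within [e / 3] of [c]. A centre of modulus below [2 e / 3] would keep the tail below
   [e], against the choice of [e]; otherwise the sign of [c] decides the alternative. *)
have [ce|] := ltP `|c| (e / 3 + e / 3).
  exfalso; apply: unull; near=> i.
  have : `|val u i - c| < e / 3 by near: i.
  by have := ler_distD c (val u i) 0; rewrite !subr0; lra.
rewrite ler_normr => /orP[ce|ce]; [left|right]; near=> i.
- have : `|val u i - c| < e / 3 by near: i.
  by rewrite ltr_norml; lra.
- have : `|val u i - c| < e / 3 by near: i.
  by rewrite ltr_norml; lra.
Unshelve. all: end_near. Qed.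

(* The terms with [val u i = 0], inverted to [0], lie outside some tail. *)
Lemma cauchyb_inv u : field_class u != 0 -> (fun i => (val u i)^-1) \in cauchyb K.
Proof.
move=> /field_class_neq0[d d0 ud].
have {}ud : \forall i \near tails K, d <= `|val u i|.
  case: ud => ud; near=> i; rewrite ler_normr; apply/orP; [left|right].
    by near: i.
  by rewrite lerNr; near: i.
apply/cauchybP => e e0.
(* The first tolerance gives [|c| >= d / 2]; the second is [e] times the lower bound for
   [|c * u i|], the denominator of the difference of inverses. *)
have [|c uc] := cauchybP _ (valP u) (Num.min (d / 2) (e * (d / 2 * d))).
  by rewrite lt_min !(divr_gt0, mulr_gt0).
have dc : d / 2 <= `|c|.
  have [i [dui]] := filter_ex (filterI ud uc).
  rewrite lt_min => /andP[+ _].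
  by have := ler_distD c (val u i) 0; rewrite !subr0; lra.
exists c^-1; near=> i.
have dui : d <= `|val u i| by near: i.
have : `|val u i - c| < Num.min (d / 2) (e * (d / 2 * d)) by near: i.
rewrite lt_min => /andP[_ h].
have u0 : val u i != 0 by rewrite -normr_gt0 (lt_le_trans d0).
have c0 : c != 0 by rewrite -normr_gt0; lra.
have -> : (val u i)^-1 - c^-1 = (c - val u i) / (c * val u i).
  by field; rewrite u0.
rewrite normrM normfV normrM distrC ltr_pdivrMr ?mulr_gt0 ?normr_gt0//.
apply: lt_le_trans h _; rewrite ler_pM2l// ler_pM//; lra.
Unshelve. all: end_near. Qed.

(** The default value of [xget] is what gives 0 the inverse 0. *)
Definition field_completion_inv x : T := xget 0 [set y | y * x = 1].

Lemma field_completion_mulVf x : x != 0 -> field_completion_inv x * x = 1.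
Proof.
have [u ->] := field_class_surj x => u0.
apply: (@xgetPex _ 0 [set y | y * field_class u = 1]).
pose v : C := cauchy_elt (cauchyb_inv u0).
exists (field_class v); rewrite /= -rmorphM -(rmorph1 field_class).
apply: field_class_near_eq.
have [d d0 ud] := field_class_neq0 u0.
have {}ud : \forall i \near tails K, val u i != 0.
  case: ud => ud; near=> i.
  - by rewrite gt_eqF// (lt_le_trans d0)//; near: i.
  - by rewrite lt_eqF//; have : val u i <= - d; [near: i|lra].
near=> i; change ((val u i)^-1 * val u i = 1).
by rewrite mulVf//; near: i.
Unshelve. all: end_near. Qed.

Lemma field_completion_inv0 : field_completion_inv 0 = 0.
Proof.
apply: xgetPN => y /=; rewrite mulr0 => /eqP.
by rewrite eq_sym oner_eq0.
Qed.

HB.instance Definition _ := GRing.ComNzRing_isField.Build T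
  field_completion_mulVf field_completion_inv0.

(** Asking for a representative of [y - x] that is nonnegative everywhere makes closure under sums
    and products a termwise matter. *)
Definition field_completion_le x y : bool :=
  `[< exists2 u, forall i, 0 <= val u i & field_class u = y - x >].

Local Notation le := field_completion_le.

Lemma field_completion_le0_add x y : le 0 x -> le 0 y -> le 0 (x + y).
Proof.
move=> /asboolP[u u0 ux] /asboolP[v v0 vy]; apply/asboolP.
exists (u + v); last by rewrite rmorphD/= ux vy !subr0.
by move=> i; apply: addr_ge0.
Qed.

Lemma field_completion_le0_mul x y : le 0 x -> le 0 y -> le 0 (x * y).
Proof.
move=> /asboolP[u u0 ux] /asboolP[v v0 vy]; apply/asboolP.
exists (u * v); last by rewrite rmorphM/= ux vy !subr0.
by move=> i; apply: mulr_ge0.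
Qed.

(** Nonnegative representatives [u] of [x] and [v] of [- x] have a null sum, and [u] lies between 0
    and [u + v]. *)
Lemma field_completion_le0_anti x : le 0 x -> le x 0 -> x = 0.
Proof.
move=> /asboolP[u u0]; rewrite subr0 => ux /asboolP[v v0]; rewrite sub0r => vx.
have /nullbP uvN : u + v \in nullb K.
  by rewrite -field_class_eq0 rmorphD/= ux vx subrr.
apply/eqP; rewrite -ux field_class_eq0; apply/nullbP => e e0.
near=> i; have : `|val (u + v) i| < e by near: i; apply: uvN.
change (`|val u i + val v i| < e -> `|val u i| < e).
by rewrite !ger0_norm ?addr_ge0//; have := v0 i; lra.
Unshelve. all: end_near. Qed.

Lemma field_completion_sub_ge0 x y : le 0 (y - x) = le x y.
Proof. by rewrite /field_completion_le subr0. Qed.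

(** The sequence of absolute values is nonnegative everywhere and agrees with [u] on a tail. *)
Lemma field_completion_near_ge0 u :
  (\forall i \near tails K, 0 <= val u i) -> le 0 (field_class u).
Proof.
move=> u0; apply/asboolP; exists (cauchy_elt (cauchyb_norm (valP u))).
  by move=> i; apply: normr_ge0.
rewrite subr0; apply: field_class_near_eq; near=> i.
by change (`|val u i| = val u i); rewrite ger0_norm//; near: i.
Unshelve. all: end_near. Qed.

Lemma field_completion_le0_total x : le 0 x || le x 0.
Proof.
have [u ->] := field_class_surj x.
have [->|/field_class_neq0[d d0 [ud|ud]]] := eqVneq (field_class u) 0.
- by apply/orP; left; apply/asboolP; exists 0 => //; rewrite rmorph0 subr0.
- rewrite field_completion_near_ge0//; near=> i.
  by rewrite (le_trans (ltW d0))//; near: i.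
- rewrite -[le (field_class u) 0]field_completion_sub_ge0 sub0r -rmorphN/=.
  rewrite (@field_completion_near_ge0 (- u)) ?orbT//; near=> i.
  change (0 <= - val u i); rewrite oppr_ge0 (@le_trans _ _ (- d))//.
    by near: i.
  by rewrite oppr_le0 ltW.
Unshelve. all: end_near. Qed.

Definition field_completion_norm x : T := if le 0 x then x else - x.

Lemma field_completion_normN x :
  field_completion_norm (- x) = field_completion_norm x.
Proof.
rewrite /field_completion_norm -[le 0 (- x)](field_completion_sub_ge0) subr0.
rewrite -sub0r field_completion_sub_ge0.
have := field_completion_le0_total x; have := @field_completion_le0_anti x.
case: (le 0 x); case: (le x 0) => //= [/(_ isT isT)->|_ _]; last by rewrite sub0r opprK.
by rewrite subrr.
Qed.

Lemma field_completion_ge0_norm x : le 0 x -> field_completion_norm x = x.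
Proof. by rewrite /field_completion_norm => ->. Qed.

HB.instance Definition _ := Num.IntegralDomain_isLeReal.Build T
  field_completion_le0_add field_completion_le0_mul field_completion_le0_anti
  field_completion_sub_ge0 field_completion_le0_total field_completion_normN
  field_completion_ge0_norm (fun _ _ => erefl).

End FieldCompletion.

(** * Density of [R], completeness and real closedness of the field of Cauchy classes *)

Section RealClosedCompletion.
Variables (R : rcfType) (K : ci_ordinal R).
Local Notation T := (field_completion K).
Local Notation C := (cauchy_ring K).

Definition field_cst (r : R) : T := field_class (cauchy_elt (cauchyb_cst K r)).

Lemma field_cst_zmod : zmod_morphism field_cst.
Proof.
move=> r s; rewrite /field_cst -rmorphB; apply: field_class_near_eq.
by near=> i.
Unshelve. all: end_near. Qed.

Lemma field_cst_monoid : monoid_morphism field_cst.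
Proof.
split=> [|r s]; rewrite /field_cst.
  rewrite -(rmorph1 (@field_class R K)); apply: field_class_near_eq.
  by near=> i.
rewrite -rmorphM; apply: field_class_near_eq; by near=> i.
Unshelve. all: end_near. Qed.

HB.instance Definition _ :=
  GRing.isZmodMorphism.Build R T field_cst field_cst_zmod.
HB.instance Definition _ :=
  GRing.isMonoidMorphism.Build R T field_cst field_cst_monoid.

(** The margin [d] matters: a sequence with positive terms may be null. *)
Lemma field_class_gt0 (u : C) d :
  0 < d -> (\forall i \near tails K, d <= val u i) -> 0 < field_class u.
Proof.
move=> d0 ud; rewrite lt_neqAle; apply/andP; split.
  rewrite eq_sym field_class_eq0; apply/negP => /nullbP/(_ _ d0) uN.
  have [i [dui]] := filter_ex (filterI ud uN).
  by rewrite ltNge (le_trans dui)// ler_norm.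
apply: field_completion_near_ge0; near=> i.
by rewrite (le_trans (ltW d0))//; near: i.
Unshelve. all: end_near. Qed.

Lemma field_cst_dense (a b : T) : a < b -> exists r, a < field_cst r < b.
Proof.
have [u ->] := field_class_surj a; have [v ->] := field_class_surj b => uv.
have := lt_eqF uv; rewrite eq_sym -subr_eq0 -rmorphB => /negbT/field_class_neq0.
move=> [d d0 [vud|vud]]; last first.
  have : 0 < field_class (u - v).
    apply: field_class_gt0 d0 _; near=> i.
    have : val (v - u) i <= - d by near: i.
    by change (val v i - val u i <= - d -> d <= val u i - val v i); lra.
  by rewrite rmorphB/= subr_gt0 ltNge (ltW uv).
have d30 : 0 < d / 3 by rewrite divr_gt0.
have d60 : 0 < d / 6 by rewrite divr_gt0.
have [c uc] := cauchybP _ (valP u) _ d30.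
(* On a tail [u] is within [d / 3] of [c] and [v] exceeds [u] by [d], so this constant stays at
   least [d / 2 - d / 3 = d / 6] away from both. *)
exists (c + d / 2); apply/andP; split; rewrite -subr_gt0 /field_cst -rmorphB.
- apply: field_class_gt0 d60 _; near=> i.
  have : `|val u i - c| < d / 3 by near: i.
  by change (`|val u i - c| < d / 3 -> d / 6 <= c + d / 2 - val u i);
    rewrite ltr_norml; lra.
- apply: field_class_gt0 d60 _; near=> i.
  have : `|val u i - c| < d / 3 by near: i.
  have : d <= val (v - u) i by near: i.
  by change (d <= val v i - val u i -> `|val u i - c| < d / 3 ->
    d / 6 <= val v i - (c + d / 2)); rewrite ltr_norml; lra.
Unshelve. all: end_near. Qed.

(** The limit is the class of the sequence itself. *)
Lemma field_cst_complete (u : K -> R^o) : kcauchy u ->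
  exists x : T^o, kcvg (field_cst \o u : K -> T^o) x.
Proof.
move=> uC; have uC' : (u : K -> R) \in cauchyb K by apply/asboolP.
pose x : T := field_class (cauchy_elt uC'); exists x => e e0.
have [r r0 re] := dense_gt0 (g := field_cst) field_cst_dense e0.
have r20 : 0 < r / 2 by rewrite divr_gt0.
have [k uk] := uC _ r20; exists k => i ki.
apply: lt_trans re; change (`|x - field_cst (u i)| < field_cst r).
have near_i : \forall l \near tails K, `|u l - u i| < r / 2.
  by exists k => l kl; have := uk i l ki kl.
rewrite ltr_norml; apply/andP; split; rewrite -subr_gt0 /x /field_cst.
- rewrite opprK -rmorphB -rmorphD.
  apply: field_class_gt0 r20 _; near=> l.
  have : `|u l - u i| < r / 2 by near: l.
  by change (`|u l - u i| < r / 2 -> r / 2 <= u l - u i + r); rewrite ltr_norml; lra.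
- rewrite -!rmorphB.
  apply: field_class_gt0 r20 _; near=> l.
  have : `|u l - u i| < r / 2 by near: l.
  by change (`|u l - u i| < r / 2 -> r / 2 <= r - (u l - u i)); rewrite ltr_norml; lra.
Unshelve. all: end_near. Qed.

Lemma field_completion_ivt : Num.real_closed_axiom T.
Proof.
move=> p a b ab /andP[pa pb]; have [e e0 ev] := ci_vanishing K.
apply: (dense_complete_ivt field_cst_dense (@ci_unbounded R K) e0 ev
  field_cst_complete) => //.
exact: mulr_le0_ge0.
Qed.

HB.instance Definition _ :=
  Num.RealField_isClosed.Build T field_completion_ivt.

End RealClosedCompletion.

(** * Limits in [S] of Cauchy sequences of [R] *)

Section DenseCompletion.
Variables (R S : rcfType) (j : {rmorphism R -> S}) (K : ci_ordinal R).
Hypothesis hS : dense_completion j.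

(** The universal property maps the field of Cauchy classes to [S] over [R]. Being order preserving,
    this map carries the limit and its tolerances from [R] along, and these suffice by density of
    [R] in [S]. *)
Lemma dense_completion_cvg (u : K -> R) : kcauchy (u : K -> R^o) ->
  exists l : S, kcvg (j \o u : K -> S^o) (l : S^o).
Proof.
have [_ /(_ (field_completion K) (@field_cst R K) (@field_cst_dense R K))] := hS.
move=> [h [hj _]] /field_cst_complete[x ux].
exists (h x) => e e0.
have [r r0 re] := dense_gt0 (g := j) (proj1 hS) e0.
have gr0 : 0 < field_cst K r by rewrite (rcf_rmorph_gt0 (@field_cst R K)).
have [k hk] := ux _ gr0; exists k => i /hk.
change (`|x - field_cst K (u i)| < field_cst K r -> `|h x - j (u i)| < e).
rewrite -(hj (u i)) /= -rmorphB -rcf_rmorph_norm -(rcf_rmorph_lt h) => /lt_trans.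
by apply; rewrite [h _]hj.
Qed.

End DenseCompletion.

(** * The metric completion *)

Lemma kcvg_unique (R : rcfType) (K : ci_ordinal R) (F : realFieldType)
    (M : metricType F) (u : K -> M) (x y : M) : kcvg u x -> kcvg u y -> x = y.
Proof.
move=> ux uy; apply: mdist_positivity; apply/eqP; rewrite eq_le mdist_ge0 andbT.
rewrite leNgt; apply/negP => xy0.
have xy20 : 0 < mdist x y / 2 by rewrite divr_gt0.
have [i [xi yi]] := filter_ex (filterI (ux _ xy20 : tails K _) (uy _ xy20 : tails K _)).
have := metric_triangle x (u i) y; rewrite (metric_sym x (u i)).
by rewrite leNgt [ltRHS]splitr ltrD.
Qed.

Section MetricCompletion.
Variables (R S : rcfType) (j : {rmorphism R -> S}) (hS : dense_completion j).
Variables (K : ci_ordinal R) (X : metricType R).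
Implicit Types (a b c : cauchy_seq K X) (x y z : completion K X).

(** By the quadrilateral inequality, distances vary by at most [d(a_i, a_i') + d(b_i, b_i')]. *)
Lemma dist_seq_cauchy a b : kcauchy (fun i => mdist (a i) (b i) : R^o).
Proof.
move=> e e0; have e20 : 0 < e / 2 by rewrite divr_gt0.
have [k ka] := cseq_cauchy a e20; have [l lb] := cseq_cauchy b e20.
exists (Order.max k l) => i i'; rewrite !gt_max => /andP[ki li] /andP[ki' li'].
change (`|mdist (a i') (b i') - mdist (a i) (b i)| < e).
have := ka _ _ ki ki'; have := lb _ _ li li'.
have := metric_triangle (a i) (a i') (b i); have := metric_triangle (a i') (b i') (b i).
have := metric_triangle (a i') (a i) (b i'); have := metric_triangle (a i) (b i) (b i').
rewrite (metric_sym (a i') (a i)) (metric_sym (b i') (b i)) ltr_norml => h1 h2 h3 h4 h5 h6.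
by apply/andP; split; lra.
Qed.

Lemma class_eqP a b : class a = class b <-> kequiv a b.
Proof.
split=> [/eqmodP/asboolP //|ab].
by apply/eqmodP/asboolP.
Qed.

Lemma kequiv_dist_seq a a' b b' (l : S) : kequiv a a' -> kequiv b b' ->
  kcvg (dist_seq j a b) (l : S^o) -> kcvg (dist_seq j a' b') (l : S^o).
Proof.
move=> aa' bb' abl e e0; have e20 : 0 < e / 2 by rewrite divr_gt0.
have [r r0 re] := dense_gt0 (g := j) (proj1 hS) e20.
have r20 : 0 < r / 2 by rewrite divr_gt0.
have na : \forall i \near tails K, mdist (a i) (a' i) < r / 2 := aa' _ r20.
have nb : \forall i \near tails K, mdist (b i) (b' i) < r / 2 := bb' _ r20.
have nl : \forall i \near tails K, `|l - j (mdist (a i) (b i))| < e / 2 := abl _ e20.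
change (\forall i \near tails K, `|l - j (mdist (a' i) (b' i))| < e).
near=> i.
have hr : `|mdist (a i) (b i) - mdist (a' i) (b' i)| < r.
  have : mdist (a i) (a' i) < r / 2 by near: i.
  have : mdist (b i) (b' i) < r / 2 by near: i.
  have := metric_triangle (a i) (a' i) (b i).
  have := metric_triangle (a' i) (b' i) (b i).
  have := metric_triangle (a' i) (a i) (b' i).
  have := metric_triangle (a i) (b i) (b' i).
  rewrite (metric_sym (a' i) (a i)) (metric_sym (b' i) (b i)) ltr_norml.
  by move=> h1 h2 h3 h4 h5 h6; apply/andP; split; lra.
move: hr; rewrite -(rcf_rmorph_lt j) rcf_rmorph_norm rmorphB => hr.
have hl : `|l - j (mdist (a i) (b i))| < e / 2 by near: i.
rewrite (le_lt_trans (ler_distD (j (mdist (a i) (b i))) _ _))//; lra.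
Unshelve. all: end_near. Qed.

(** Distances between the chosen representatives form a Cauchy sequence of [R], so they have a limit
    in [S] and the default of [xget] is not reached; the limit then transfers to the equivalent [a]
    and [b]. *)
Lemma dbar_cvg a b : kcvg (dist_seq j a b) (dbar j (class a) (class b) : S^o).
Proof.
have ra : kequiv (repr (class a)) a by apply/class_eqP; rewrite /class reprK.
have rb : kequiv (repr (class b)) b by apply/class_eqP; rewrite /class reprK.
apply: (kequiv_dist_seq ra rb).
exact: (xgetPex _ (dense_completion_cvg hS (dist_seq_cauchy _ _))).
Qed.

Lemma dbar_lt a b (r : R) : dbar j (class a) (class b) < j r ->
  \forall i \near tails K, mdist (a i) (b i) < r.
Proof.
rewrite -subr_gt0 => /(dbar_cvg a b) [k hk]; exists k => i /hk.
change (`|dbar j (class a) (class b) - j (mdist (a i) (b i))| <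
  j r - dbar j (class a) (class b) -> mdist (a i) (b i) < r).
by rewrite -(rcf_rmorph_lt j) ltr_norml => /andP[]; lra.
Qed.

Lemma dbar_le a b (s : S) :
  (\forall i \near tails K, j (mdist (a i) (b i)) <= s) ->
  dbar j (class a) (class b) <= s.
Proof.
move=> abs; rewrite leNgt -subr_gt0; apply/negP => /(dbar_cvg a b) h.
have [i [i1 i2]] := filter_ex (filterI abs (h : tails K _)).
move: i2; change (~ (`|dbar j (class a) (class b) - j (mdist (a i) (b i))| <
  dbar j (class a) (class b) - s)).
by rewrite ltr_norml => /andP[]; lra.
Qed.

Lemma class_surj x : exists a, x = class a.
Proof. by exists (repr x); rewrite /class reprK. Qed.

Lemma dbar_is_metric : is_metric (@dbar R K X S j).
Proof.
have rmj r : (0 <= j r) = (0 <= r) by rewrite -(rmorph0 j) rcf_rmorph_le.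
split=> [x y|x y|x y|x y z].
- have [a ->] := class_surj x; have [b ->] := class_surj y.
  rewrite leNgt; apply/negP; rewrite -oppr_gt0 => /(dbar_cvg a b) h.
  have [i] := filter_ex (h : tails K _).
  change (~ (`|dbar j (class a) (class b) - j (mdist (a i) (b i))| <
    - dbar j (class a) (class b))).
  have : 0 <= j (mdist (a i) (b i)) by rewrite rmj mdist_ge0.
  by move=> d0; rewrite ltr_norml => /andP[]; lra.
- have [a ->] := class_surj x; have [b ->] := class_surj y.
  split=> [ab0|/class_eqP ab].
    apply/class_eqP => r r0; apply: dbar_lt.
    by rewrite ab0 (rcf_rmorph_gt0 j).
  apply: (kcvg_unique (dbar_cvg a b)) => e e0.
  have [r r0 re] := dense_gt0 (g := j) (proj1 hS) e0.
  have [k hk] := ab _ r0; exists k => i /hk.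
  change (mdist (a i) (b i) < r -> `|0 - j (mdist (a i) (b i))| < e).
  rewrite -(rcf_rmorph_lt j) sub0r normrN ger0_norm ?rmj ?mdist_ge0//.
  by move=> /lt_trans; apply.
- rewrite /dbar; congr (xget _ _); apply/seteqP.
  by split=> l h e /h[k hk]; exists k => i /hk; rewrite /dist_seq (metric_sym (repr x i)).
- have [a ->] := class_surj x; have [b ->] := class_surj y; have [c ->] := class_surj z.
  (* A slack [e] is allowed, and each distance on the right is approximated to within [e / 2] at a
     late index. *)
  apply/ler_addgt0Pr => e e0; apply: dbar_le.
  have e20 : 0 < e / 2 by rewrite divr_gt0.
  have nab : \forall i \near tails K, `|dbar j (class a) (class b) - j (mdist (a i) (b i))| < e / 2.
    exact: dbar_cvg.
  have nbc : \forall i \near tails K, `|dbar j (class b) (class c) - j (mdist (b i) (c i))| < e / 2.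
    exact: dbar_cvg.
  near=> i.
  have : `|dbar j (class a) (class b) - j (mdist (a i) (b i))| < e / 2 by near: i.
  have : `|dbar j (class b) (class c) - j (mdist (b i) (c i))| < e / 2 by near: i.
  have := metric_triangle (a i) (b i) (c i).
  rewrite -(rcf_rmorph_le j) rmorphD !ltr_norml => h1 /andP[h2 h3] /andP[h4 h5].
  by lra.
Unshelve. all: end_near. Qed.

Lemma dbar_iota (p q : X) :
  dbar j (iota_completion K p) (iota_completion K q) = j (mdist p q).
Proof.
apply: (kcvg_unique (dbar_cvg _ _)) => e e0.
by have [k _] := ci_inhabited K; exists k => i _; rewrite mdistxx.
Qed.

(** A late term of a Cauchy sequence is close to all later ones, so its constant sequence is close
    to the class. *)
Lemma iota_dense x (e : S) : 0 < e -> exists p, dbar j x (iota_completion K p) < e.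
Proof.
move=> e0; have [r r0 re] := dense_gt0 (g := j) (proj1 hS) e0.
have [a ->] := class_surj x.
have [k hk] := cseq_cauchy a r0; have [l kl] := ci_unbounded k.
exists (a l); apply: le_lt_trans re; apply: dbar_le; exists k => i ki.
by rewrite rcf_rmorph_le ltW//; apply: hk.
Qed.

Lemma completion_kcomplete (hd : is_metric (@dbar R K X S j)) :
  kcomplete K (metrized hd).
Proof.
move=> u uC; have [_ _ dsym dtri] := hd.
have [e e0 ev] := ci_vanishing K.
(* Diagonal sequence: [y i] is a point of [X] within [j (e i)] of [u i], and its class will be the
   limit of [u]. *)
have /choice[y hy] : forall i, exists p, dbar j (u i) (iota_completion K p) < j (e i).
  by move=> i; apply: iota_dense; rewrite (rcf_rmorph_gt0 j).
have eve r : 0 < r -> exists k, forall i, (k < i)%O -> e i < r.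
  move=> r0; have [k hk] := ev _ r0; exists k => i /hk.
  by rewrite /mdist/= sub0r normrN gtr0_norm.
have yC : kcauchy y.
  (* The path from [y i] through [u i] and [u i'] to [y i'] has three legs, each less than a third
     of [r]. *)
  move=> r r0; have r30 : 0 < r / 3 by rewrite divr_gt0.
  have [k hk] := eve _ r30.
  have jr30 : 0 < j (r / 3) by rewrite (rcf_rmorph_gt0 j).
  have [l hl] := uC _ jr30.
  exists (Order.max k l) => i i'; rewrite !gt_max => /andP[ki li] /andP[ki' li'].
  rewrite -(rcf_rmorph_lt j) -dbar_iota.
  have := hy i; have := hy i'.
  have := hk _ ki; have := hk _ ki'; rewrite -2!(rcf_rmorph_lt j).
  have : dbar j (u i) (u i') < j (r / 3) := hl _ _ li li'.
  have := dtri (iota_completion K (y i)) (u i) (iota_completion K (y i')).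
  have := dtri (u i) (u i') (iota_completion K (y i')).
  rewrite (dsym (iota_completion K (y i)) (u i)).
  have -> : j r = j (r / 3) + j (r / 3) + j (r / 3) by rewrite -!rmorphD; congr (j _); lra.
  by move=> h1 h2 h3 h4 h5 h6 h7; lra.
pose z := class (CauchySeq yC); exists z => t t0.
have t20 : 0 < t / 2 by rewrite divr_gt0.
(* Both the distance from [u i] to [y i] and that from [y i] to [z] will be at most [j r], hence
   below [t / 2]. *)
have [r r0 rt] := dense_gt0 (g := j) (proj1 hS) t20.
have [k hk] := eve _ r0; have [l hl] := yC _ r0.
exists (Order.max k l) => i; rewrite gt_max => /andP[ki li].
change (dbar j (u i) z < t).
have yz : dbar j (iota_completion K (y i)) z <= j r.
  apply: dbar_le; exists l => i' li'.
  by rewrite rcf_rmorph_le ltW//; apply: hl.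
have := hk _ ki; rewrite -(rcf_rmorph_lt j).
have := dtri (u i) (iota_completion K (y i)) z; have := hy i.
by move=> h1 h2 h3; lra.
Qed.

End MetricCompletion.

Theorem proposition3p12 (R S : rcfType) (j : {rmorphism R -> S})
    (hS : dense_completion j) (K : ci_ordinal R) (X : metricType R) :
  (forall (a b : cauchy_seq K X) (l : S),
     kcvg (dist_seq j a b) (l : S^o) <-> l = dbar j (class a) (class b)) /\
  exists hd : is_metric (@dbar R K X S j),
    [/\ kcomplete K (metrized hd),
        forall x y : X,
          mdist (iota_completion K x : metrized hd)
                (iota_completion K y : metrized hd) = j (mdist x y) &
        dense (range (fun x : X => iota_completion K x : metrized hd))].
Proof.
split=> [a b l|].
  split=> [abl|->]; last exact: dbar_cvg.
  exact: (kcvg_unique abl (dbar_cvg hS a b)).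
exists (dbar_is_metric hS K X); split.
- exact: completion_kcomplete.
- exact: dbar_iota.
- move=> O [x Ox] oO.
  have /nbhs_ballP[e e0] : nbhs x O by apply: open_nbhs_nbhs.
  rewrite ballEmdist => eO.
  have [p xp] := iota_dense hS x e0.
  by exists (iota_completion K p); split; [apply: eO|exists p].
Qed.
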